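(* Let $K\ge 0$ be an integer and let $a_0,\ldots,a_K$ be real random variables whose joint probability distribution is palindromic, such that $P\big((a_0,\ldots,a_K)\neq(0,\ldots,0)\big)>0$. Let $C(x)=\sum_{k=0}^{K}a_k\cos(kx)$. Then the expected number of real zeros of $C$ in one period, taken over those $C$ which are not identically zero, is at least $K$; that is, $$\mathbb{E}\big[\,Z(C)\,\big|\,C\not\equiv 0\,\big]\ \ge\ K .$$
   Context: A joint probability distribution on $a_0,\ldots,a_K$ is called palindromic if the $a_k$ are independent and $(a_0,\ldots,a_K)$ has the same distribution as $(a_K,\ldots,a_0)$. For a real trigonometric polynomial $f$ that is not identically zero, $Z(f)$ denotes the number of real zeros of $f$ in one period $[0,2\pi)$, counted with multiplicity. The expectation is conditional on the event that $C$ is not identically zero (equivalently, that $(a_0,\ldots,a_K)\neq(0,\ldots,0)$). *)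

(* Defs.v *)
From HB Require Import structures.
From mathcomp Require Import all_boot all_order all_algebra.
From mathcomp Require Import all_classical all_reals all_analysis.

Set Implicit Arguments.
Unset Strict Implicit.
Unset Printing Implicit Defensive.

Import Order.TTheory GRing.Theory Num.Theory.
Import numFieldNormedType.Exports.

Local Open Scope classical_set_scope.
Local Open Scope ring_scope.

Definition mutually_independent d (T : measurableType d) (R : realType)
    (P : probability T R) (n : nat) (X : 'I_n -> {RV P >-> R}) : Prop :=
  forall (J : {set 'I_n}) (B : 'I_n -> set R),
    (forall k, measurable (B k)) ->
    P (\bigcap_(k in [set` J]) X k @^-1` B k) =
    (\prod_(k in J) P (X k @^-1` B k))%E.

(* Equality of the two laws on [n.-tuple R] is only required on measurable
   sets: [pushforward] is a total function on arbitrary sets. *)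
Definition palindromic d (T : measurableType d) (R : realType)
    (P : probability T R) (n : nat) (X : 'I_n -> {RV P >-> R}) : Prop :=
  mutually_independent X /\
  forall A : set (n.-tuple R), measurable A ->
    pushforward P (fun w => [tuple X k w | k < n]) A =
    pushforward P (fun w => [tuple X (rev_ord k) w | k < n]) A.

Definition cos_poly (R : realType) (K : nat) (c : 'I_K.+1 -> R) (x : R) : R :=
  \sum_(k < K.+1) c k * cos (k%:R * x).

(* The order of vanishing: the largest [n] such that [f] and its first [n - 1]
   derivatives vanish at [x] ([+oo] if all of them do, [0] if [f x != 0]). *)
Definition zero_mult (R : realType) (f : R -> R) (x : R) : \bar R :=
  ereal_sup [set n%:R%:E | n in
    [set n : nat | forall i : nat, (i < n)%N -> f^`(i)%classic x = 0]].

Definition num_zeros (R : realType) (f : R -> R) : \bar R :=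
  \esum_(x in [set x : R | 0 <= x < 2 * pi /\ f x = 0]) zero_mult f x.

(* [Y] is meant to be nonnegative and [E] to have positive probability. *)
Definition cond_expectation d (T : measurableType d) (R : realType)
    (P : probability T R) (E : set T) (Y : T -> \bar R) : \bar R :=
  ((\int[P]_(w in E) Y w) / P E)%E.

(* Main.v *)
Require Import Defs.
From HB Require Import structures.
From mathcomp Require Import all_boot all_order all_algebra.
From mathcomp Require Import all_classical all_reals all_analysis.
From mathcomp Require Import measurable_realfun zify ring lra.
Import Order.TTheory GRing.Theory Num.Theory.
Import numFieldNormedType.Exports.
Local Open Scope classical_set_scope.
Local Open Scope ring_scope.
(** Let C* be the cosine polynomial with the reversed coefficients.  Since
    cos ((K - k) j pi / K) = (-1)^j cos (k j pi / K), we have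
    C*(x_j) = (-1)^j C(x_j) at the 2K + 1 nodes x_j = j pi / K of [0, 2 pi].
    Hence, when C vanishes at neither x_j nor x_(j+1), exactly one of C and C*
    changes sign between them; and when C(x_j) = 0, both C and C* vanish there,
    which pays for the two subintervals adjacent to x_j.  So the zeros that are
    visible from the signs at the nodes number at least 2K for C and C*
    together.  This count of visible zeros is a measurable function of the
    coefficients and has the same integral for C as for C*, so each integral is
    at least K P(C <> 0). *)

(** * Zeros detected from signs *)

(* Chosen to depend on the signs of [f] at [a] and [b] only, which makes it
   measurable in the coefficients when [f] is a cosine polynomial. *)
Definition detects_zero {R : realType} (f : R -> R) (a b : R) : bool :=
  (f a == 0) || (f a * f b < 0).

(** The zero is [a] itself, or else [f a * f b < 0] forces [f b != 0], so the zero given by the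
    intermediate value theorem is not [b]. *)
Lemma detects_zeroP (R : realType) (f : R -> R) (a b : R) :
  continuous f -> a < b -> detects_zero f a b ->
  exists2 c, a <= c < b & f c = 0.
Proof.
move=> cf ab /orP[/eqP fa0|fab]; first by exists a; rewrite ?lexx.
have [||c /[1!in_itv]/= /andP[ac]] := @IVT R f a b 0 (ltW ab).
- exact: continuous_subspaceT.
- rewrite ge_min le_max; move: fab; have [fa|fa|->] := ltgtP (f a) 0.
  + by rewrite nmulr_rlt0// => /ltW ->; rewrite orbT.
  + by rewrite pmulr_rlt0// => /ltW ->.
  + by rewrite mul0r ltxx.
rewrite le_eqVlt => /predU1P[->|cb] fc0; last by exists c; rewrite ?ac.
by rewrite fc0 mulr0 ltxx in fab.
Qed.

Lemma zero_mult_ge1 (R : realType) (f : R -> R) (x : R) :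
  f x = 0 -> (1 <= zero_mult f x)%E.
Proof. by move=> fx0; apply: ereal_sup_ubound; exists 1%N => // -[]. Qed.

Lemma zero_mult_ge0 (R : realType) (f : R -> R) (x : R) :
  (0 <= zero_mult f x)%E.
Proof. by apply: ereal_sup_ubound; exists 0%N. Qed.

Lemma num_zeros_ge0 (R : realType) (f : R -> R) : (0 <= num_zeros f)%E.
Proof. by apply: esum_ge0 => x _; exact: zero_mult_ge0. Qed.

(** Zeros picked in disjoint half-open intervals are distinct, and each has multiplicity at least 1.
    Excluding right ends also keeps them below [2 * pi]. *)
Lemma num_zeros_ge (R : realType) (f : R -> R) (n : nat) (x : nat -> R) :
  continuous f -> {homo x : i j / (i < j)%N >-> i < j} ->
  0 <= x 0%N -> x n <= 2 * pi ->
  ((\sum_(j < n) detects_zero f (x j) (x j.+1))%N%:R%:E <= num_zeros f)%E.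
Proof.
move=> cf x_incr x0 xn.
have x_ndecr : {homo x : i j / (i <= j)%N >-> i <= j}.
  by move=> i j; rewrite leq_eqVlt => /predU1P[->//|/x_incr/ltW].
have /choice[y yP] (j : nat) : exists c, detects_zero f (x j) (x j.+1) ->
    x j <= c < x j.+1 /\ f c = 0.
  have [/detects_zeroP|] := boolP (detects_zero f (x j) (x j.+1)).
    by case=> // [|c cj fc0]; [exact: x_incr|exists c].
  by exists 0.
pose J := `I_n `&` [set j | detects_zero f (x j) (x j.+1)].
have y_inj : set_inj J y.
  move=> i j /set_mem[_ /yP[/andP[xi yi] _]] /set_mem[_ /yP[/andP[xj yj] _]] yij.
  apply/eqP; rewrite eqn_leq; apply/andP; split; rewrite leqNgt; apply/negP.
    move=> /x_ndecr /(lt_le_trans yj) /lt_le_trans /(_ xi).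
    by rewrite yij ltxx.
  move=> /x_ndecr /(lt_le_trans yi) /lt_le_trans /(_ xj).
  by rewrite yij ltxx.
have finJ : finite_set J by exact/finite_setIl.
apply: esum_ge; exists (y @` J).
  split; first exact: finite_image.
  move=> _ [j [/= jn /yP[/andP[xj yj] fy0]] <-]; split => //.
  rewrite (le_trans _ xj) ?(le_trans x0) ?x_ndecr//=.
  by rewrite (lt_le_trans yj)// (le_trans _ xn)// x_ndecr.
apply: (@le_trans _ _ (\sum_(t \in y @` J) 1)%E); last first.
  apply: lee_fsum => [|_ [j [_ /yP[_ fy0]] <-]]; first exact: finite_image.
  exact: zero_mult_ge1.
rewrite fsbig_image// fsbig_mkcondr -fsbig_ord natr_sum -sumEFin.
rewrite le_eqVlt; apply/orP; left; apply/eqP; apply: eq_bigr => j _ /=.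
case: ifPn => [/set_mem/=->//|]; rewrite notin_setE/= => /negP/negbTE->//.
Qed.

(** * Cosine polynomials and their reversals at the nodes *)

Lemma continuous_cos_poly (R : realType) (K : nat) (c : 'I_K.+1 -> R) :
  continuous (cos_poly c).
Proof.
apply: continuous_big => [|k _ x]; first exact: add_continuous.
apply: cvgM; first exact: cvg_cst.
apply: continuous_comp; last exact: continuous_cos.
by apply: cvgM; [exact: cvg_cst|exact: cvg_id].
Qed.

Lemma cos_natmulpi (R : realType) (n : nat) : cos (n%:R * pi) = (-1) ^+ n :> R.
Proof.
elim: n => [|n IHn]; first by rewrite mul0r cos0.
by rewrite -natr1 mulrDl mul1r cosDpi IHn exprSr mulrN1.
Qed.

Lemma sin_natmulpi (R : realType) (n : nat) : sin (n%:R * pi) = 0 :> R.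
Proof.
elim: n => [|n IHn]; first by rewrite mul0r sin0.
by rewrite -natr1 mulrDl mul1r sinDpi IHn oppr0.
Qed.

(* For [K = 0] all nodes are [0], as [x / 0 = 0]. *)
Definition node (R : realType) (K j : nat) : R := j%:R * pi / K%:R.

Lemma cos_poly_rev_node (R : realType) (K : nat) (c : 'I_K.+1 -> R) (j : nat) :
  (0 < K)%N ->
  cos_poly (c \o @rev_ord _) (node R K j) =
  (-1) ^+ j * cos_poly c (node R K j).
Proof.
move=> K_gt0; rewrite /cos_poly (reindex_inj rev_ord_inj) mulr_sumr.
apply: eq_bigr => k _; rewrite /= rev_ordK subSS natrB -1?ltnS// mulrBl.
have -> : K%:R * node R K j = j%:R * pi.
  by rewrite /node mulrC divfK// pnatr_eq0 -lt0n.
by rewrite cosB cos_natmulpi sin_natmulpi mul0r addr0 mulrCA.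
Qed.

Lemma cos_poly_node_period (R : realType) (K : nat) (c : 'I_K.+1 -> R) :
  (0 < K)%N -> cos_poly c (node R K (2 * K)) = cos_poly c (node R K 0).
Proof.
move=> K_gt0; apply: eq_bigr => k _.
have -> : node R K (2 * K) = 2 * pi.
  by rewrite /node natrM mulrAC mulfK// pnatr_eq0 -lt0n.
rewrite /node !mul0r mulr0 cos0 mulrA -natrM cos_natmulpi.
by rewrite mulnC exprM sqrrN !expr1n.
Qed.

(** The terms for [f a == 0] and [f b == 0] are credits: an interval ending at a zero may detect
    nothing, but the next one, starting there, detects for both functions and passes its surplus
    back. *)
Lemma detects_zero_alternating (R : realType) (f g : R -> R) (a b e : R) :
  e ^+ 2 = 1 -> g a = e * f a -> g b = - e * f b ->
  ((1 + (f a == 0%R)) <=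
    (detects_zero f a b + detects_zero g a b) + (f b == 0%R))%N.
Proof.
rewrite /detects_zero => e2 ga gb.
have e_neq0 : e != 0 by apply: contra_eq_neq e2 => ->; rewrite expr0n eq_sym oner_neq0.
have -> : (g a == 0) = (f a == 0) by rewrite ga mulf_eq0 (negbTE e_neq0).
have -> : g a * g b = - (f a * f b).
  by rewrite ga gb mulrACA mulrN -expr2 e2 mulN1r.
have [//|fa0] := eqVneq (f a) 0; have [|fb0] := eqVneq (f b) 0.
  by rewrite addn1.
by have := mulf_neq0 fa0 fb0; rewrite oppr_lt0 neq_lt => /orP[] ->;
  rewrite ?orbT// addnC ?addn1.
Qed.

Lemma leq_telescope_sum (n : nat) (u d : nat -> nat) :
  (forall j, (1 + u j <= d j + u j.+1)%N) ->
  (n + u 0 <= \sum_(j < n) d j + u n)%N.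
Proof.
move=> ud; elim: n => [|n IHn]; first by rewrite big_ord0.
rewrite big_ord_recr/=; have := ud n; move: IHn.
by set s := (\sum_(j < n) d j)%N; move: s => s; lia.
Qed.

Lemma detected_zeros_rev (R : realType) (K : nat) (c : 'I_K.+1 -> R) :
  (2 * K <= \sum_(j < 2 * K)
     (detects_zero (cos_poly c) (node R K j) (node R K j.+1) +
      detects_zero (cos_poly (c \o @rev_ord _)) (node R K j) (node R K j.+1)))%N.
Proof.
have [K0|K_gt0] := posnP K; first by rewrite {1}K0.
(* By periodicity the credits at the nodes 0 and [2 * K] are equal, so they cancel after
   telescoping. *)
rewrite -(leq_add2r (cos_poly c (node R K 0) == 0)).
rewrite -{2}(cos_poly_node_period _ _ c K_gt0).
apply: (@leq_telescope_sum (2 * K) (fun j => cos_poly c (node R K j) == 0)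
  (fun j => detects_zero (cos_poly c) (node R K j) (node R K j.+1) +
    detects_zero (cos_poly (c \o @rev_ord _)) (node R K j) (node R K j.+1))%N).
move=> j; apply: (@detects_zero_alternating _ _ _ _ _ ((-1) ^+ j)).
- by rewrite sqrr_sign.
- exact: cos_poly_rev_node.
- by rewrite cos_poly_rev_node// exprS mulN1r.
Qed.

(** Linear independence of the cosines, needed to express the conditioning event through the
    coefficients. *)
Lemma cos_poly_eq0 (R : realType) (K : nat) (c : 'I_K.+1 -> R) :
  cos_poly c = (fun=> 0) -> forall k, c k = 0.
Proof.
move=> c0 k0.
(* The angles [k * h] with [k <= K] lie in [[0, pi]], where [cos] is injective, so their cosines are
   pairwise distinct. *)
pose h : R := pi / K.+1%:R.
(* [C(x + h) + C(x - h)] multiplies the [k]-th coefficient by [2 cos (k h)], so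
   shifts can filter out every frequency but [k0]. *)
pose S (s : seq 'I_K.+1) x := \sum_(k < K.+1)
  c k * (\prod_(j <- s) (cos (k%:R * h) - cos (j%:R * h))) * cos (k%:R * x).
have S_eq0 s x : S s x = 0.
  elim: s x => [|i s IHs] x.
    transitivity (cos_poly c x); last by rewrite c0.
    by apply: eq_bigr => k _; rewrite big_nil mulr1.
  transitivity ((S s (x + h) + S s (x - h)) / 2 - cos (i%:R * h) * S s x).
    rewrite -big_split/= mulr_suml mulr_sumr -sumrB; apply: eq_bigr => k _.
    by rewrite big_cons mulrDr mulrBr cosD cosB; field.
  by rewrite !IHs addr0 mul0r mulr0 subr0.
(* What remains is [c k0] times a product of differences of distinct cosines. *)
have /eqP := S_eq0 [seq j <- enum 'I_K.+1 | j != k0] 0.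
rewrite /S (bigD1 k0)//= [X in _ + X]big1 => [|k k_neq]; last first.
  apply/eqP; rewrite mulf_eq0 mulf_eq0 prodf_seq_eq0; apply/orP; left.
  apply/orP; right; apply/hasP; exists k; last by rewrite subrr eqxx.
  by rewrite mem_filter k_neq mem_enum.
rewrite addr0 mulr0 cos0 mulr1 mulf_eq0 => /orP[/eqP//|].
rewrite prodf_seq_eq0 => /hasP[j]; rewrite mem_filter => /andP[j_neq _] /=.
have itv (i : 'I_K.+1) : i%:R * h \in `[0, pi].
  rewrite in_itv/=; apply/andP; split.
    by rewrite mulr_ge0// divr_ge0// pi_ge0.
  rewrite mulrCA ler_piMr ?pi_ge0// ler_pdivrMr// mul1r ler_nat.
  exact: ltnW.
rewrite subr_eq0 => /eqP/(cos_inj (itv _) (itv _)).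
move=> /(mulIf _) /eqP; rewrite eqr_nat => jk.
case/eqP: j_neq; apply/esym/val_inj/eqP/jk.
by rewrite mulf_neq0 ?gt_eqF ?pi_gt0.
Qed.

(** * Integration and measurability *)

(* [num_zeros] is not known to be measurable in the coefficients, so
   [ge0_le_integral] does not apply. *)
Lemma ge0_le_integral_nonmeasurable d (T : measurableType d) (R : realType)
    (mu : {measure set T -> \bar R}) (D : set T) (f g : T -> \bar R) :
  (forall x, D x -> 0 <= f x)%E -> (forall x, D x -> f x <= g x)%E ->
  (\int[mu]_(x in D) f x <= \int[mu]_(x in D) g x)%E.
Proof.
move=> f0 fg; rewrite !ge0_integralE//; last first.
  by move=> x Dx; exact: le_trans (f0 _ Dx) (fg _ Dx).
(* The integral is a supremum over simple functions below the integrand, and each one below [f] is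
   below [g]. *)
apply: ereal_sup_le => _ [h hf <-]; exists h => // x.
by rewrite (le_trans (hf x))// lee_restrict.
Qed.

Lemma measurable_detects_zero (R : realType) (K : nat) (x y : R) :
  measurable [set t : K.+1.-tuple R | detects_zero (cos_poly (tnth t)) x y].
Proof.
have mC z : measurable_fun setT (fun t : K.+1.-tuple R => cos_poly (tnth t) z).
  apply: measurable_sum => k; apply: measurable_funM => //.
  exact: measurable_tnth.
have -> : [set t : K.+1.-tuple R | detects_zero (cos_poly (tnth t)) x y] =
    (fun t : K.+1.-tuple R => cos_poly (tnth t) x) @^-1` [set 0] `|`
    (fun t : K.+1.-tuple R => cos_poly (tnth t) x * cos_poly (tnth t) y)
      @^-1` `]-oo, 0[.
  apply/seteqP; split => t; rewrite /= /detects_zero in_itv/=.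
    by move=> /orP[/eqP|]; [left|right].
  by move=> [->|->]; rewrite ?eqxx ?orbT.
apply: measurableU; rewrite -[X in measurable X]setTI.
  exact: mC.
by apply: measurable_funM.
Qed.

Lemma measurable_tuple_neq0 (R : realType) (n : nat) :
  measurable [set t : n.-tuple R | exists k, tnth t k <> 0].
Proof.
have -> : [set t : n.-tuple R | exists k, tnth t k <> 0] =
    \bigcup_(k in [set: 'I_n]) (fun t : n.-tuple R => tnth t k) @^-1` [set~ 0].
  by apply/seteqP; split => [t [k tk]|t [k _ tk]]; exists k.
apply: fin_bigcup_measurable => [|k _]; first exact: finite_finset.
rewrite -[X in measurable X]setTI.
apply: measurable_tnth => //; exact: measurableC.
Qed.

(** * From sign counts to the conditional expectation *)

Theorem theorem1p2 (R : realType) (d : measure_display) (T : measurableType d)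
    (P : probability T R) (K : nat) (a : 'I_K.+1 -> {RV P >-> R})
    (a_pal : palindromic a)
    (a_neq0 : (0 < P [set w | exists k, a k w <> 0%R])%E) :
  (K%:R%:E <=
    cond_expectation P
      [set w | cos_poly (fun k => a k w) <> (fun=> 0%R)]
      (fun w => num_zeros (cos_poly (fun k => a k w))))%E.
Proof.
(* For [K = 0] the nodes all coincide, but the bound is mere nonnegativity. *)
have [K0|K_gt0] := posnP K.
  rewrite /cond_expectation {1}K0 mule_ge0//.
    by apply: integral_ge0 => w _; exact: num_zeros_ge0.
  by rewrite inve_ge0.
pose V w := [tuple a k w | k < K.+1].
pose V' w := [tuple a (rev_ord k) w | k < K.+1].
have VE w : tnth (V w) = fun k => a k w.
  by apply/funext => k; rewrite tnth_mktuple.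
have V'E w : tnth (V' w) = tnth (V w) \o @rev_ord _.
  by apply/funext => k; rewrite /= !tnth_mktuple.
have mV : measurable_fun setT V.
  apply/measurable_fun_tnthP => k.
  by apply: (eq_measurable_fun (a k)) => // w _; rewrite /= tnth_mktuple.
have mV' : measurable_fun setT V'.
  apply/measurable_fun_tnthP => k.
  by apply: (eq_measurable_fun (a (rev_ord k))) => // w _; rewrite /= tnth_mktuple.
pose G := [set t : K.+1.-tuple R | exists k, tnth t k <> 0].
have mG : measurable G by exact: measurable_tuple_neq0.
pose E := V @^-1` G.
have mE : measurable E by rewrite -[E]setTI; exact: mV.
(* Reversal only permutes the coefficients, so [E] can be read off from either vector. *)
have E_V' : E = V' @^-1` G.
  apply/seteqP; split => w [k]; rewrite ?V'E/= => ?.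
    by exists (rev_ord k); rewrite V'E/= rev_ordK.
  by exists (rev_ord k).
have -> : [set w | cos_poly (fun k => a k w) <> (fun=> 0)] = E.
  apply/seteqP; split => w /=; rewrite -VE.
    move=> C0; apply: contrapT => /forallNP c0; apply: C0.
    apply/funext => x; apply: big1 => k _.
    by have /contrapT -> := c0 k; rewrite mul0r.
  by move=> [k ck] /cos_poly_eq0.
have {a_neq0}PE : (0 < P E)%E.
  by move: a_neq0; congr (0 < P _)%E; apply/seteqP; split => w [k ck]; exists k;
    rewrite VE in ck *.
pose S j := [set t : K.+1.-tuple R |
  detects_zero (cos_poly (tnth t)) (node R K j) (node R K j.+1)].
have mS j : measurable (S j) by exact: measurable_detects_zero.
have mVS j : measurable (V @^-1` S j).
  by rewrite -[X in measurable X]setTI; exact: mV.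
have mV'S j : measurable (V' @^-1` S j).
  by rewrite -[X in measurable X]setTI; exact: mV'.
(* With the preimages of [S j] under [V] or [V'], this counts the subintervals where a zero of C or
   of C* is detected. *)
pose L (A : nat -> set T) w : \bar R := (\sum_(j < 2 * K) (\1_(A j) w)%:E)%E.
have L_ge0 A w : (0 <= L A w)%E by apply: sume_ge0 => j _; rewrite lee_fin.
have mL A : (forall j, measurable (A j)) -> measurable_fun E (L A).
  move=> mA; apply: emeasurable_sum => j.
  by apply/measurable_EFinP; exact: measurable_indic.
have int_L A : (forall j, measurable (A j)) ->
    (\int[P]_(w in E) L A w = \sum_(j < 2 * K) P (A j `&` E))%E.
  move=> mA; rewrite ge0_integral_sum//.
  - by apply: eq_bigr => j _; rewrite integral_indic.
  - by move=> j; apply/measurable_EFinP; exact: measurable_indic.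
pose I := (\int[P]_(w in E) L (fun j => V @^-1` S j) w)%E.
have I_V' : I = (\int[P]_(w in E) L (fun j => V' @^-1` S j) w)%E.
  rewrite /I !int_L//; apply: eq_bigr => j _.
  (* Equality of the two laws enters here. *)
  rewrite {2}E_V'; have [_ /(_ (S j `&` G) (measurableI _ _ (mS j) mG))] := a_pal.
  by [].
have II : ((2 * K)%:R%:E * P E <= I + I)%E.
  rewrite {2}I_V' -ge0_integralD//; [|exact: mL..].
  rewrite -integral_cst//; apply: ge0_le_integral_nonmeasurable => w _.
    by rewrite lee_fin.
  rewrite /L /= -big_split/=.
  apply: (@le_trans _ _ (\sum_(j < 2 * K)
    (detects_zero (cos_poly (tnth (V w))) (node R K j) (node R K j.+1) +
     detects_zero (cos_poly (tnth (V w) \o @rev_ord _))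
       (node R K j) (node R K j.+1)))%N%:R%:E).
    by rewrite lee_fin ler_nat detected_zeros_rev.
  rewrite natr_sum -sumEFin; apply: lee_sum => j _.
  rewrite natrD EFinD -V'E !indicE.
  by rewrite !mem_setE.
have IZ : (I <= \int[P]_(w in E) num_zeros (cos_poly (fun k => a k w)))%E.
  apply: ge0_le_integral_nonmeasurable => // w _; rewrite -VE.
  apply: le_trans (@num_zeros_ge _ _ (2 * K) (node R K) _ _ _ _).
  - rewrite natr_sum -sumEFin; apply: lee_sum => j _.
    by rewrite indicE mem_setE.
  - exact: continuous_cos_poly.
  - move=> i j ij; rewrite ltr_pM2r ?invr_gt0 ?ltr0n//.
    by rewrite ltr_pM2r ?pi_gt0// ltr_nat.
  - by rewrite /node !mul0r.
  - by rewrite /node natrM mulrAC mulfK// pnatr_eq0 -lt0n.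
rewrite /cond_expectation.
have [p PEp] : exists p, P E = p%:E by exists (fine (P E)); rewrite fineK ?fin_num_measure.
move: PE II; rewrite PEp lte_fin => p_gt0 II.
rewrite inver gt_eqF// lee_pdivlMr//; apply: le_trans IZ.
(* If [I] is infinite the bound is immediate; otherwise [II] is halved. *)
case: (I) II => [r| |]//; rewrite ?leey// -!EFinM -EFinD !lee_fin natrM; lra.
Qed.
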